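(* Let $\mathbf{n}\in\mathfrak{gl}_n(\mathbb{R})$ be a nilpotent matrix with nilpotency index $p\ge 2$, let $\mathbf{m}$ be its conjugate transpose, and let $\bar{\mathbf{n}},\bar{\mathbf{m}},\bar{\mathbf{h}}$ and $\bar{\mathbf{n}}_\star,\bar{\mathbf{m}}_\star,\bar{\mathbf{h}}_\star$ be as defined in the context. On $\mathcal{P}^n$ put $$\nabla_{\bar{\mathbf{n}}}=\bar{\mathbf{n}}-\bar{\mathbf{n}}_\star,\qquad \nabla_{\bar{\mathbf{m}}}=\bar{\mathbf{m}}-\bar{\mathbf{m}}_\star,\qquad \Delta_{\bar{\mathbf{h}}}=\bar{\mathbf{h}}+\bar{\mathbf{h}}_\star .$$ Then $\langle\nabla_{\bar{\mathbf{m}}},\Delta_{\bar{\mathbf{h}}},\nabla_{\bar{\mathbf{n}}}\rangle$ is an $\mathfrak{sl}_2$-triple, i.e. $$[\nabla_{\bar{\mathbf{m}}},\nabla_{\bar{\mathbf{n}}}]=\Delta_{\bar{\mathbf{h}}},\qquad [\Delta_{\bar{\mathbf{h}}},\nabla_{\bar{\mathbf{m}}}]=2\nabla_{\bar{\mathbf{m}}},\qquad [\Delta_{\bar{\mathbf{h}}},\nabla_{\bar{\mathbf{n}}}]=-2\nabla_{\bar{\mathbf{n}}}.$$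
   Context: $P_k$ is the space of real homogeneous polynomials of degree $k$ in $x_1,\dots,x_n$; $\mathcal{P}^n_k=P_{k+1}\otimes\mathbb{R}^n$ for $k\ge 0$, and $\mathcal{P}^n=\prod_{k\ge 0}\mathcal{P}^n_k$ (formal vector-valued maps $\varphi$ with $\varphi(0)=0$). A matrix $A\in\mathfrak{gl}_n(\mathbb{R})$ acts on $\mathcal{P}^n$ by multiplication, $(A\varphi)(x)=A\,\varphi(x)$, and by substitution, $(A_\star\varphi)(x)=\varphi(Ax)$. Conjugate transpose: let $\mathsf{N}$ be the (upper triangular) Jordan normal form of $\mathbf{n}$, let $P\in GL_n(\mathbb{R})$ satisfy $\mathbf{n}=P^{-1}\mathsf{N}P$, and let $\mathsf{M}=\mathsf{N}^t$; then $\mathbf{m}:=P^{-1}\mathsf{M}P$. The nilpotency index of $\mathbf{n}$ is the least $p$ with $\mathbf{n}^p=0$. Define the matrices (acting on $\mathcal{P}^n$ by multiplication) $$\bar{\mathbf{n}}=\mathbf{n},\quad \bar{\mathbf{m}}=\sum_{i=1}^{p-1}\sum_{l=0}^{i-1}\mathbf{n}^{l}\mathbf{m}^{i}\mathbf{n}^{i-l-1},\quad \bar{\mathbf{h}}=\sum_{i=1}^{p-1}[\mathbf{m}^{i},\mathbf{n}^{i}],$$ and the operators on $\mathcal{P}^n$ $$\bar{\mathbf{n}}_\star=\mathbf{n}_\star,\quad \bar{\mathbf{m}}_\star=\sum_{i=1}^{p-1}\sum_{l=0}^{i-1}(\mathbf{n}_\star)^{l}(\mathbf{m}_\star)^{i}(\mathbf{n}_\star)^{i-l-1},\quad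 \bar{\mathbf{h}}_\star=\sum_{i=1}^{p-1}[(\mathbf{m}_\star)^{i},(\mathbf{n}_\star)^{i}].$$ Here $\bar{\mathbf{m}}_\star$, $\bar{\mathbf{h}}_\star$ are given by these formulas and are not the substitution operators of the matrices $\bar{\mathbf{m}}$, $\bar{\mathbf{h}}$. $[X,Y]=XY-YX$. *)

(* Defs.v *)
From HB Require Import structures.
From mathcomp Require Import all_boot all_order all_algebra.
From mathcomp Require Import boolp functions reals prodnormedzmodule.
From mathcomp Require Import mpoly.

Set Implicit Arguments.
Unset Strict Implicit.
Unset Printing Implicit Defensive.

Import GRing.Theory.
Local Open Scope ring_scope.

(* The ring End(V): the sum is pointwise and the product is composition,
   (f * g) v = f (g v). *)
Section EndRing.
Variables (R : pzRingType) (V : lmodType R).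
Implicit Types f g h : {linear V -> V}.

Lemma linear_ext f g : f =1 g -> f = g.
Proof.
case: f => f [[a1] [b1]]; case: g => g [[a2] [b2]] efg.
have {}efg : f = g by apply: funext => x; exact: efg.
subst g; congr (GRing.Linear.Pack (GRing.Linear.Class _ _)).
  by congr (Algebra.isNmodMorphism.Axioms_ _ _); exact: Prop_irrelevance.
by congr (GRing.isScalable.Axioms_ _ _ _); exact: Prop_irrelevance.
Qed.

Definition end_zero : {linear V -> V} := \0.
Definition end_opp f : {linear V -> V} := \- f.
Definition end_add f g : {linear V -> V} := f \+ g.
Definition end_one : {linear V -> V} := idfun.
Definition end_mul f g : {linear V -> V} := f \o g.

Lemma end_addA : associative end_add.
Proof. by move=> f g h; apply: linear_ext => x /=; rewrite addrA. Qed.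
Lemma end_addC : commutative end_add.
Proof. by move=> f g; apply: linear_ext => x /=; rewrite addrC. Qed.
Lemma end_add0 : left_id end_zero end_add.
Proof. by move=> f; apply: linear_ext => x /=; rewrite add0r. Qed.
Lemma end_addN : left_inverse end_zero end_opp end_add.
Proof. by move=> f; apply: linear_ext => x /=; rewrite addNr. Qed.

HB.instance Definition _ := GRing.isZmodule.Build {linear V -> V}
  end_addA end_addC end_add0 end_addN.

Lemma end_mulA : associative end_mul.
Proof. by move=> f g h; exact: linear_ext. Qed.
Lemma end_mul1 : left_id end_one end_mul.
Proof. by move=> f; exact: linear_ext. Qed.
Lemma end_1mul : right_id end_one end_mul.
Proof. by move=> f; exact: linear_ext. Qed.
Lemma end_mulDl : left_distributive end_mul +%R.
Proof. by move=> f g h; exact: linear_ext. Qed.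
Lemma end_mulDr : right_distributive end_mul +%R.
Proof. by move=> f g h; apply: linear_ext => x /=; rewrite linearD. Qed.

HB.instance Definition _ := GRing.Zmodule_isPzRing.Build {linear V -> V}
  end_mulA end_mul1 end_1mul end_mulDl end_mulDr.

Lemma endD f g x : (f + g) x = f x + g x. Proof. by []. Qed.
Lemma endN f x : (- f) x = - f x. Proof. by []. Qed.
Lemma endM f g x : (f * g) x = f (g x). Proof. by []. Qed.

End EndRing.

Definition lie_bracket (E : pzRingType) (x y : E) : E := x * y - y * x.

Definition bar_m (E : pzRingType) (p : nat) (a b : E) : E :=
  \sum_(1 <= i < p) \sum_(0 <= l < i) a ^+ l * b ^+ i * a ^+ (i - l - 1).

Definition bar_h (E : pzRingType) (p : nat) (a b : E) : E :=
  \sum_(1 <= i < p) lie_bracket (b ^+ i) (a ^+ i).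

Definition is_sl2_triple (E : pzRingType) (x h y : E) : Prop :=
  [/\ lie_bracket x y = h,
      lie_bracket h x = x *+ 2 &
      lie_bracket h y = - (y *+ 2)].

Definition has_nilpotency_index (E : pzRingType) (a : E) (p : nat) : Prop :=
  a ^+ p = 0 /\ forall q, (q < p)%N -> a ^+ q <> 0.

Definition jordan_block (R : pzRingType) (d : nat) (a : R) : 'M[R]_d :=
  \matrix_(i, j) (a *+ (i == j) + (i.+1 == j)%:R).

Definition is_jordan_normal_form (R : pzRingType) (n : nat) (J : 'M[R]_n) :=
  exists (k : nat) (d : 'I_k -> nat) (a : 'I_k -> R)
         (e : (\sum_i d i)%N = n),
    (forall i, (0 < d i)%N) /\
    J = castmx (e, e) (\mxdiag_i jordan_block (d i) (a i)).

Section FormalMaps.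
Variables (R : comNzRingType) (n : nat).

(* The k-th factor is P_(k+1) (x) R^n: n-tuples of homogeneous polynomials of
   degree k+1. *)
Definition formal_map := forall k : nat, {ffun 'I_n -> dhomog n R k.+1}.

HB.instance Definition _ := Choice.on formal_map.

Lemma formal_mapP (f g : formal_map) : (forall k, f k = g k) -> f = g.
Proof. exact: functional_extensionality_dep. Qed.

Definition fm_zero : formal_map := fun=> 0.
Definition fm_opp (f : formal_map) : formal_map := fun k => - f k.
Definition fm_add (f g : formal_map) : formal_map := fun k => f k + g k.
Definition fm_scale (c : R) (f : formal_map) : formal_map :=
  fun k => c *: f k.

Lemma fm_addA : associative fm_add.
Proof. by move=> f g h; apply: formal_mapP => k; exact: addrA. Qed.
Lemma fm_addC : commutative fm_add.
Proof. by move=> f g; apply: formal_mapP => k; exact: addrC. Qed.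
Lemma fm_add0 : left_id fm_zero fm_add.
Proof. by move=> f; apply: formal_mapP => k; exact: add0r. Qed.
Lemma fm_addN : left_inverse fm_zero fm_opp fm_add.
Proof. by move=> f; apply: formal_mapP => k; exact: addNr. Qed.

HB.instance Definition _ := GRing.isZmodule.Build formal_map
  fm_addA fm_addC fm_add0 fm_addN.

Lemma fm_scaleA a b v : fm_scale a (fm_scale b v) = fm_scale (a * b) v.
Proof. by apply: formal_mapP => k; exact: scalerA. Qed.
Lemma fm_scale1 : left_id 1 fm_scale.
Proof. by move=> f; apply: formal_mapP => k; exact: scale1r. Qed.
Lemma fm_scaleDr : right_distributive fm_scale +%R.
Proof. by move=> c f g; apply: formal_mapP => k; exact: scalerDr. Qed.
Lemma fm_scaleDl v : {morph fm_scale^~ v : a b / a + b}.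
Proof. by move=> a b; apply: formal_mapP => k; exact: scalerDl. Qed.

HB.instance Definition _ := GRing.Zmodule_isLmodule.Build R formal_map
  fm_scaleA fm_scale1 fm_scaleDr fm_scaleDl.

Variable A : 'M[R]_n.

Definition mul_map (phi : formal_map) : formal_map :=
  fun k => [ffun i => \sum_j A i j *: phi k j].

Lemma mul_map_is_linear : linear mul_map.
Proof.
move=> c f g; apply: formal_mapP => k; apply/ffunP => i.
rewrite !ffunE scaler_sumr -big_split; apply: eq_bigr => j _ /=.
by rewrite !ffunE scalerDr !scalerA mulrC.
Qed.

HB.instance Definition _ :=
  GRing.isLinear.Build R formal_map formal_map _ mul_map mul_map_is_linear.

(* The i-th coordinate of A x, as a linear form in x. *)
Definition linear_forms : n.-tuple {mpoly R[n]} :=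
  [tuple \sum_j A i j *: 'X_j | i < n].

Lemma subst_homog d (q : {mpoly R[n]}) :
  q \is d.-homog -> q \mPo linear_forms \is d.-homog.
Proof.
move=> /dhomogP hq; rewrite comp_mpolyEX big_seq; apply: rpred_sum => m mq.
rewrite dhomogZ // comp_mpolyX -(hq _ mq) /= mdegE.
elim/big_rec2: _ => [|i d' r _ hr]; first exact: dhomog1.
apply: dhomogM => //; rewrite -[X in X.-homog]mul1n.
apply: dhomogMn; rewrite tnth_mktuple; apply: rpred_sum => j _.
by rewrite dhomogZ // dhomogX /= mdeg1.
Qed.

Definition subst_homogeneous d (q : dhomog n R d) : dhomog n R d :=
  DHomog (subst_homog (dhomog_is_dhomog q)).

Definition subst_map (phi : formal_map) : formal_map :=
  fun k => [ffun i => subst_homogeneous (phi k i)].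

Lemma subst_map_is_linear : linear subst_map.
Proof.
move=> c f g; apply: formal_mapP => k; apply/ffunP => i.
by apply: val_inj; rewrite !ffunE /= linearP.
Qed.

HB.instance Definition _ :=
  GRing.isLinear.Build R formal_map formal_map _ subst_map subst_map_is_linear.

Definition mul_op : {linear formal_map -> formal_map} := mul_map.
Definition subst_op : {linear formal_map -> formal_map} := subst_map.

Lemma mul_opE phi k i : mul_op phi k i = \sum_j A i j *: phi k j.
Proof. by rewrite ffunE. Qed.

Lemma subst_opE phi k i :
  val (subst_op phi k i) = val (phi k i) \mPo linear_forms.
Proof. by rewrite ffunE. Qed.

End FormalMaps.

Section Operators.
Variables (R : comNzRingType) (n p : nat) (a b : 'M[R]_n).

Definition nabla_bar_n : {linear formal_map R n -> formal_map R n} :=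
  mul_op a - subst_op a.

Definition nabla_bar_m : {linear formal_map R n -> formal_map R n} :=
  mul_op (bar_m p a b) - bar_m p (subst_op a) (subst_op b).

Definition Delta_bar_h : {linear formal_map R n -> formal_map R n} :=
  mul_op (bar_h p a b) + bar_h p (subst_op a) (subst_op b).

End Operators.

(* Main.v *)
(* In any ring, [bar_m, a] telescopes to [bar_h].  If a b a = a, b a b = b,
   a b commutes with every b^i a^i, b a with every a^i b^i, and a^p = 0, then a
   and b have weights -2 and 2 under [bar_h], so (bar_m, bar_h, a) is an
   sl2-triple.  A nilpotent Jordan matrix is a partial permutation matrix, and
   together with its transpose it satisfies these relations because the
   idempotents involved are diagonal.  The relations are invariant under
   conjugation and under reversing the order of multiplication, so they pass
   to the substitution operators, since A |-> A_star is an antimorphism.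
   As multiplications commute with substitutions, the two triples combine. *)

From HB Require Import structures.
Require Import Defs.
From mathcomp Require Import all_boot all_order all_algebra.
From mathcomp Require Import reals mpoly zify.

Set Implicit Arguments.
Unset Strict Implicit.
Unset Printing Implicit Defensive.

Import GRing.Theory.
Local Open Scope ring_scope.

(** * Weights and [sl2]-triples in an arbitrary ring *)

Section LieBracket.
Variable E : pzRingType.
Implicit Types (x y h a b : E) (k : int).

Lemma lie_bracketDl x y z :
  lie_bracket (x + y) z = lie_bracket x z + lie_bracket y z.
Proof. by rewrite /lie_bracket mulrDl mulrDr opprD addrACA. Qed.

Lemma lie_bracketDr x y z :
  lie_bracket z (x + y) = lie_bracket z x + lie_bracket z y.
Proof. by rewrite /lie_bracket mulrDl mulrDr opprD addrACA. Qed.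

Lemma lie_bracketNl x y : lie_bracket (- x) y = - lie_bracket x y.
Proof. by rewrite /lie_bracket mulNr mulrN opprB opprK addrC. Qed.

Lemma lie_bracketNr x y : lie_bracket x (- y) = - lie_bracket x y.
Proof. by rewrite /lie_bracket mulNr mulrN opprB opprK addrC. Qed.

Lemma lie_bracketC x y : lie_bracket x y = - lie_bracket y x.
Proof. by rewrite /lie_bracket opprB. Qed.

Lemma lie_bracket_eq0 x y : GRing.comm x y -> lie_bracket x y = 0.
Proof. by rewrite /lie_bracket => ->; rewrite subrr. Qed.

Lemma lie_bracketMr h x y :
  lie_bracket h (x * y) = lie_bracket h x * y + x * lie_bracket h y.
Proof. by rewrite /lie_bracket mulrBl mulrBr !mulrA addrA subrK. Qed.

(** Eigenvectors of [ad h] for an integer eigenvalue. As [ad h] is a derivation, weights add under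
    products. *)
Definition has_weight h x k := lie_bracket h x = x *~ k.

Lemma has_weight1 h : has_weight h 1 0.
Proof. by rewrite /has_weight lie_bracket_eq0 // /GRing.comm mulr1 mul1r. Qed.

Lemma has_weightM h x y k l :
  has_weight h x k -> has_weight h y l -> has_weight h (x * y) (k + l).
Proof.
rewrite /has_weight lie_bracketMr => -> ->.
by rewrite mulrzAl mulrzAr mulrzDr.
Qed.

Lemma has_weightX h x k m : has_weight h x k -> has_weight h (x ^+ m) (k *+ m).
Proof.
move=> wx; elim: m => [|m IH]; first exact: has_weight1.
by rewrite exprS mulrS; exact: has_weightM.
Qed.

Lemma has_weight0 h k : has_weight h 0 k.
Proof. by rewrite /has_weight /lie_bracket mulr0 mul0r subrr mul0rz. Qed.

Lemma has_weightD h x y k :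
  has_weight h x k -> has_weight h y k -> has_weight h (x + y) k.
Proof.
rewrite /has_weight /lie_bracket => wx wy.
by rewrite mulrDl mulrDr opprD addrACA wx wy -mulrzDl.
Qed.

Lemma has_weight_sum h (I : eqType) (r : seq I) (F : I -> E) k :
  (forall i, i \in r -> has_weight h (F i) k) ->
  has_weight h (\sum_(i <- r) F i) k.
Proof.
move=> wF; rewrite big_seq; apply: (big_ind (fun x => has_weight h x k)) => //.
  exact: has_weight0.
by move=> x y; exact: has_weightD.
Qed.

(** The first two relations make [a b] and [b a] idempotent. The whole system is symmetric in [a]
    and [b]. *)
Definition quasi_inverse a b : Prop :=
  [/\ a * b * a = a, b * a * b = b,
      forall i, GRing.comm (a * b) (b ^+ i * a ^+ i) &
      forall i, GRing.comm (b * a) (a ^+ i * b ^+ i)].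

Lemma quasi_inverseC a b : quasi_inverse a b -> quasi_inverse b a.
Proof. by case. Qed.

Lemma bar_hC p a b : bar_h p b a = - bar_h p a b.
Proof. by rewrite -sumrN; apply: eq_bigr => i _; exact: lie_bracketC. Qed.

Lemma bracket_bar_m p a b : lie_bracket (bar_m p a b) a = bar_h p a b.
Proof.
rewrite /lie_bracket mulr_suml mulr_sumr -sumrB; apply: eq_bigr => i _.
rewrite mulr_suml mulr_sumr -sumrB.
(* The l-th summand of the bracket is [f l.+1 - f l]; the end values [f i] and [f 0] are [- a^i b^i]
   and [- b^i a^i]. *)
pose f l := - (a ^+ l * b ^+ i * a ^+ (i - l)).
rewrite (eq_big_nat _ _ (F2 := fun l => f l.+1 - f l)).
  by rewrite telescope_sumr // /f subnn subn0 !expr0 mulr1 mul1r opprK addrC.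
move=> l /andP[_ lti]; rewrite /f opprK [RHS]addrC -mulrA -exprSr.
by rewrite -subnDA addn1 subnSK // !mulrA -exprS.
Qed.

(* The relations turn [b^i a^(i+1)] into [a b^(i+1) a^(i+1)] and [a^(i+1) b^i]
   into [a^(i+1) b^(i+1) a], so that the sum telescopes. *)
Lemma bracket_bar_h p a b : (0 < p)%N -> quasi_inverse a b ->
  a ^+ p * b ^+ p = 0 -> b ^+ p * a ^+ p = 0 ->
  has_weight (bar_h p a b) a (-2).
Proof.
move=> p_gt0 [aba _ cab cba] abp bap.
pose f i := a * (b ^+ i * a ^+ i) + a ^+ i * b ^+ i * a.
rewrite /has_weight /lie_bracket mulr_suml mulr_sumr -sumrB.
rewrite (eq_bigr (fun i => f i.+1 - f i)) => [|i _].
  (* What remains is [f p - f 1], where [f p = 0] and [f 1 = a b a + a b a = 2 a]; hence the weight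
     -2. *)
  rewrite telescope_sumr // /f abp bap mulr0 mul0r addr0 sub0r !expr1 mulrA.
  by rewrite aba mulrNz -mulr2n.
have e1 : a * (b ^+ i.+1 * a ^+ i.+1) = b ^+ i * a ^+ i * a.
  rewrite exprS exprSr.
  transitivity (a * b * (b ^+ i * a ^+ i) * a); first by rewrite !mulrA.
  by rewrite cab -mulrA aba.
have e2 : a ^+ i.+1 * b ^+ i.+1 * a = a * (a ^+ i * b ^+ i).
  rewrite exprS exprSr.
  transitivity (a * (a ^+ i * b ^+ i * (b * a))); first by rewrite !mulrA.
  by rewrite -cba !mulrA aba.
rewrite /f e1 e2 /lie_bracket mulrBl mulrBr opprB addrACA -opprD.
by rewrite [X in _ - X]addrC.
Qed.

Lemma bar_sl2_triple p a b : (0 < p)%N -> quasi_inverse a b -> a ^+ p = 0 ->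
  is_sl2_triple (bar_m p a b) (bar_h p a b) a.
Proof.
move=> p_gt0 qab ap0.
have wa : has_weight (bar_h p a b) a (-2).
  by apply: bracket_bar_h; rewrite ?ap0 ?mul0r ?mulr0.
have wb : has_weight (bar_h p a b) b 2.
  (* Exchanging [a] and [b] changes the sign of [bar_h], so weight -2 becomes weight 2. *)
  have := bracket_bar_h p_gt0 (quasi_inverseC qab).
  rewrite ap0 mul0r mulr0 bar_hC /has_weight lie_bracketNl mulrNz.
  by move=> /(_ erefl erefl) /oppr_inj.
split; [exact: bracket_bar_m | | by rewrite wa mulrNz].
rewrite -[RHS]/(_ *~ 2) /bar_m -/(has_weight _ _ 2).
apply: has_weight_sum => i _; apply: has_weight_sum => l.
rewrite mem_index_iota => /andP[_ lti].
(* Each monomial of [bar_m] has weight [-2 l + 2 i - 2 (i - l - 1) = 2]. *)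
have := has_weightM (has_weightM (has_weightX l wa) (has_weightX i wb))
  (has_weightX (i - l - 1) wa).
by congr has_weight; lia.
Qed.

(** The mixed brackets vanish, and the two minus signs cancel in the bracket of [- x'] with [- y'];
    this is why the middle terms add. *)
Lemma sl2_tripleB x h y x' h' y' :
  is_sl2_triple x h y -> is_sl2_triple x' h' y' ->
  (forall u v, u \in [:: x; h; y] -> v \in [:: x'; h'; y'] -> GRing.comm u v) ->
  is_sl2_triple (x - x') (h + h') (y - y').
Proof.
move=> [xy hx hy] [xy' hx' hy'] cuv.
have c1 u v :
    u \in [:: x; h; y] -> v \in [:: x'; h'; y'] -> lie_bracket u v = 0.
  by move=> uP vP; apply: lie_bracket_eq0; exact: cuv.
have c2 u v :
    u \in [:: x; h; y] -> v \in [:: x'; h'; y'] -> lie_bracket v u = 0.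
  by move=> uP vP; rewrite lie_bracketC c1 ?oppr0.
have mem3 (t1 t2 t3 : E) : [/\ t1 \in [:: t1; t2; t3], t2 \in [:: t1; t2; t3] &
  t3 \in [:: t1; t2; t3]] by rewrite !inE !eqxx !orbT.
have [mx mh my] := mem3 x h y; have [mx' mh' my'] := mem3 x' h' y'.
split; rewrite !(lie_bracketDl, lie_bracketDr) !(lie_bracketNl, lie_bracketNr).
- by rewrite (c1 x y') // (c2 y x') // xy xy' opprK oppr0 addr0 add0r.
- by rewrite (c1 h x') // (c2 x h') // hx hx' oppr0 addr0 add0r mulrnBl.
- rewrite (c1 h y') // (c2 y h') // hy hy' oppr0 addr0 add0r.
  by rewrite mulrnBl opprB opprK addrC.
Qed.

End LieBracket.

(** * Transport along morphisms and antimorphisms *)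

Section Transport.
Variables (E F : pzRingType).

Lemma sl2_triple_rmorph (f : {rmorphism E -> F}) x h y :
  is_sl2_triple x h y -> is_sl2_triple (f x) (f h) (f y).
Proof.
have fB u v : lie_bracket (f u) (f v) = f (lie_bracket u v).
  by rewrite rmorphB !rmorphM.
by case=> xy hx hy; split; rewrite fB ?xy ?hx ?hy ?rmorphN ?rmorphMn.
Qed.

(** The relations involve products alone, which suits substitution, in general not additive in the
    matrix. Reversing products exchanges the two commutation conditions. *)
Lemma quasi_inverse_antimorph (f : E -> F) a b :
  f 1 = 1 -> {morph f : x y / x * y >-> y * x} ->
  quasi_inverse a b -> quasi_inverse (f a) (f b).
Proof.
move=> f1 fM [aba bab cab cba].
have fX x i : f x ^+ i = f (x ^+ i).
  by elim: i => [|i IH]; rewrite ?f1 // exprSr exprS IH fM.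
split=> [||i|i]; rewrite ?fX -!fM ?mulrA ?aba ?bab //.
- by rewrite /GRing.comm -!fM cba.
- by rewrite /GRing.comm -!fM cab.
Qed.

End Transport.

(** * Partial permutation matrices and their transposes *)

Section PartialPermutation.
Variables (R : comPzRingType) (n : nat).
Implicit Types J D : 'M[R]_n.

Definition is_partial_perm_mx J : Prop :=
  [/\ forall i j, J i j != 0 -> J i j = 1,
      forall i j k, J i j != 0 -> J i k != 0 -> j = k &
      forall i j k, J i k != 0 -> J j k != 0 -> i = j].

Lemma is_partial_perm_mx_tr J : is_partial_perm_mx J -> is_partial_perm_mx J^T.
Proof.
case=> J01 Jr Jc; split=> [i j|i j k|i j k]; rewrite !mxE;
  [exact: J01 | exact: Jc | exact: Jr].
Qed.

(** A nonzero entry at [(i, j)] would need some column [k] with [J i k] and [J j k] both nonzero,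
    which forces [i = j]. *)
Lemma partial_perm_mx_conj_diag J D :
  is_partial_perm_mx J -> is_diag_mx D -> is_diag_mx (J *m D *m J^T).
Proof.
case=> _ _ Jc /diag_mxP[d ->]; apply/is_diag_mxP => i j neq_ij.
rewrite mul_mx_diag mxE big1 // => k _; rewrite !mxE.
have [->|nz_ik] := eqVneq (J i k) 0; first by rewrite !mul0r.
have [->|nz_jk] := eqVneq (J j k) 0; first by rewrite mulr0.
by rewrite (Jc _ _ _ nz_ik nz_jk) eqxx in neq_ij.
Qed.

Lemma partial_perm_mx_diag_expr J i :
  is_partial_perm_mx J -> is_diag_mx (J ^+ i * J^T ^+ i).
Proof.
move=> pJ; elim: i => [|i IH].
  by rewrite !expr0 mulr1; exact: scalar_mx_is_diag.
have -> : J ^+ i.+1 * J^T ^+ i.+1 = J *m (J ^+ i * J^T ^+ i) *m J^T.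
  by rewrite exprS exprSr -[RHS]/(J * (J ^+ i * J^T ^+ i) * J^T) !mulrA.
exact: partial_perm_mx_conj_diag.
Qed.

(** The diagonal matrix [J J^T] has entry 1 at every nonzero row of [J], so it fixes [J] from the
    left. *)
Lemma partial_perm_mxK J : is_partial_perm_mx J -> J * J^T * J = J.
Proof.
move=> pJ; have [J01 Jr Jc] := pJ; apply/matrixP => i l.
have /diag_mxP[d dE] := partial_perm_mx_diag_expr 1 pJ.
rewrite !expr1 in dE; rewrite dE -[_ * J]/(_ *m J) mul_diag_mx mxE.
have [->|nz] := eqVneq (J i l) 0; first by rewrite mulr0.
have -> : d 0 i = (J *m J^T) i i by rewrite [J *m _]dE mxE eqxx.
rewrite mxE (bigD1 l) //= big1 ?addr0 => [|k /negP neq_kl].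
  by rewrite mxE (J01 _ _ nz) !mulr1.
have [->|nzk] := eqVneq (J i k) 0; first by rewrite mul0r.
by case: neq_kl; rewrite (Jr _ _ _ nzk nz).
Qed.

Lemma quasi_inverse_partial_perm_mx J :
  is_partial_perm_mx J -> quasi_inverse J J^T.
Proof.
move=> pJ; have pJT := is_partial_perm_mx_tr pJ.
have comm_diag D D' : is_diag_mx D -> is_diag_mx D' -> GRing.comm D D'.
  by move=> /diag_mxP[d ->] /diag_mxP[d' ->]; exact: diag_mxC.
split=> [||i|i].
- exact: partial_perm_mxK.
- by have := partial_perm_mxK pJT; rewrite trmxK.
- apply: comm_diag; first exact: (partial_perm_mx_diag_expr 1).
  by have := partial_perm_mx_diag_expr i pJT; rewrite trmxK.
- apply: comm_diag; last exact: partial_perm_mx_diag_expr.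
  by have := partial_perm_mx_diag_expr 1 pJT; rewrite trmxK.
Qed.

End PartialPermutation.

(** * The entries of a nilpotent Jordan matrix *)

Lemma mxdiagE (V : nmodType) k (d : 'I_k -> nat) (B : forall i, 'M[V]_(d i))
    (i j : 'I_(\sum_i d i)) :
  (\mxdiag_i B i) i j = 0 \/
  exists u (s t : 'I_(d u)) m,
    [/\ (\mxdiag_i B i) i j = B u s t, i = (m + s)%N :> nat &
        j = (m + t)%N :> nat].
Proof.
rewrite mxE; have [eq_ij|_] := eqVneq; last by left; rewrite mxE.
right; exists (tagnat.sig1 i), (tagnat.sig2 i).
have := tagnat.rect i; have := tagnat.rect j.
move: (tagnat.sig2 i) (tagnat.sig2 j); rewrite -eq_ij => s t jE iE.
(* The offset [m] is the total size of the preceding blocks. *)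
by exists t, (\sum_(l < k | l < tagnat.sig1 i) d l)%N; rewrite conform_mx_id.
Qed.

Lemma jordan_normal_form_offdiag (R : pzRingType) n (J : 'M[R]_n) i j :
  is_jordan_normal_form J -> i != j -> J i j != 0 ->
  J i j = 1 /\ i.+1 = j :> nat.
Proof.
case=> k [d [a [e [_ JE]]]]; subst n; rewrite JE castmx_id => neq_ij.
have [->|[u [s [t [m [-> iE jE]]]]]] :=
  mxdiagE (fun i => jordan_block (d i) (a i)) i j.
  by rewrite eqxx.
rewrite mxE; have [eq_st|_] := eqVneq s t.
  by case/eqP: neq_ij; apply: val_inj; rewrite /= iE jE eq_st.
rewrite add0r; have [eq_st _|_] := s.+1 =P t; last by rewrite eqxx.
by split=> //; rewrite iE jE -eq_st addnS.
Qed.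

(** Used to show that a nilpotent Jordan matrix has zero diagonal. Triangularity of the powers is
    carried along because it kills the other terms of a diagonal entry. *)
Lemma expr_upper_trig_diag (R : pzRingType) n (J : 'M[R]_n) m :
  (forall i j : 'I_n, (j < i)%N -> J i j = 0) ->
  (forall i j : 'I_n, (j < i)%N -> (J ^+ m) i j = 0) /\
  forall i, (J ^+ m) i i = J i i ^+ m.
Proof.
move=> trigJ; elim: m => [|m [IHt IHd]].
  by split=> i *; rewrite mxE ?eqxx // -val_eqE gtn_eqF.
have JS i j : (J ^+ m.+1) i j = \sum_k J i k * (J ^+ m) k j.
  by rewrite exprS mxE.
split=> [i j lt_ji|i]; rewrite JS.
  apply: big1 => k _; have [/trigJ ->|le_ik] := ltnP k i; first by rewrite mul0r.
  by rewrite IHt ?mulr0 // (leq_trans lt_ji).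
rewrite (bigD1 i) //= big1 ?addr0 ?IHd -?exprS // => k neq_ki.
have [/trigJ ->|] := ltnP k i; first by rewrite mul0r.
rewrite leq_eqVlt => /predU1P[/val_inj eq_ik|/IHt ->]; last by rewrite mulr0.
by rewrite eq_ik eqxx in neq_ki.
Qed.

Lemma nilpotent_jordan_partial_perm_mx (R : idomainType) n (J : 'M[R]_n) p :
  is_jordan_normal_form J -> J ^+ p = 0 -> is_partial_perm_mx J.
Proof.
move=> JNF Jp0.
have [|_ diagJ] := @expr_upper_trig_diag R n J p.
  move=> i j lt_ji; apply/eqP; case: eqP => // /eqP nz.
  have neq_ij : i != j by rewrite -val_eqE gtn_eqF.
  have [_ ij] := jordan_normal_form_offdiag JNF neq_ij nz.
  by rewrite -ij ltnNge leqnSn in lt_ji.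
(* The p-th power of each diagonal entry is a diagonal entry of [J ^+ p = 0], and [R] is a
   domain. *)
have J0 i : J i i = 0.
  apply/eqP; have := diagJ i; rewrite Jp0 mxE => /esym/eqP.
  by rewrite expf_eq0 => /andP[].
have nzJ i j : J i j != 0 -> J i j = 1 /\ i.+1 = j :> nat.
  have [->|neq_ij] := eqVneq i j; first by rewrite J0 eqxx.
  exact: jordan_normal_form_offdiag.
split=> [i j /nzJ[] //|i j k /nzJ[_ ij] /nzJ[_ ik]|i j k /nzJ[_ ik] /nzJ[_ jk]].
  by apply: val_inj; rewrite /= -ij -ik.
by apply: val_inj; apply: succn_inj; rewrite /= ik jk.
Qed.

(** * Conjugation by an invertible matrix *)

Section Conjugation.
Variables (R : comUnitRingType) (n : nat) (P : 'M[R]_n).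
Hypothesis unitP : P \in unitmx.

Definition conj_invmx (X : 'M[R]_n) : 'M[R]_n := invmx P *m X *m P.

Lemma conj_invmx1 : conj_invmx 1 = 1.
Proof. by rewrite /conj_invmx mulmx1 mulVmx. Qed.

Lemma conj_invmxM X Y : conj_invmx (X * Y) = conj_invmx X * conj_invmx Y.
Proof.
rewrite -[RHS]/(conj_invmx X *m conj_invmx Y) /conj_invmx !mulmxA.
by rewrite (mulmxK unitP).
Qed.

Lemma conj_invmxX X m : conj_invmx X ^+ m = conj_invmx (X ^+ m).
Proof.
by elim: m => [|m IH]; rewrite ?conj_invmx1 // !exprS IH conj_invmxM.
Qed.

Lemma conj_invmx_eq0 X : conj_invmx X = 0 -> X = 0.
Proof.
move=> X0; have : P *m conj_invmx X *m invmx P = 0 by rewrite X0 mulmx0 mul0mx.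
by rewrite /conj_invmx !mulmxA mulmxV // mul1mx mulmxK.
Qed.

Lemma quasi_inverse_conj X Y :
  quasi_inverse X Y -> quasi_inverse (conj_invmx X) (conj_invmx Y).
Proof.
case=> XYX YXY cXY cYX; split=> [||i|i].
- by rewrite -!conj_invmxM XYX.
- by rewrite -!conj_invmxM YXY.
- by rewrite !conj_invmxX /GRing.comm -!conj_invmxM cXY.
- by rewrite !conj_invmxX /GRing.comm -!conj_invmxM cYX.
Qed.

End Conjugation.

(** * Multiplication and substitution operators on formal maps *)

Lemma comp_mpolyA (R : comNzRingType) n k l (q : {mpoly R[n]})
    (f : n.-tuple {mpoly R[k]}) (g : k.-tuple {mpoly R[l]}) :
  (q \mPo f) \mPo g = q \mPo [tuple tnth f i \mPo g | i < n].
Proof.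
rewrite [q \mPo f]comp_mpolyEX [RHS]comp_mpolyEX raddf_sum.
apply: eq_bigr => m _ /=.
rewrite comp_mpolyZ !comp_mpolyX rmorph_prod; congr (_ *: _).
by apply: eq_bigr => i _; rewrite rmorphXn tnth_mktuple.
Qed.

Section FormalMapOperators.
Variables (R : comNzRingType) (n : nat).
Implicit Types A B : 'M[R]_n.

Lemma comp_linear_forms A B :
  [tuple tnth (linear_forms B) i \mPo linear_forms A | i < n] =
  linear_forms (B *m A).
Proof.
apply: eq_from_tnth => i; rewrite !tnth_mktuple raddf_sum /=.
under eq_bigr => j _ do
  rewrite comp_mpolyZ comp_mpolyXU -tnth_nth tnth_mktuple scaler_sumr.
rewrite exchange_big; apply: eq_bigr => k _ /=.
by rewrite mxE scaler_suml; apply: eq_bigr => j _; rewrite scalerA.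
Qed.

Lemma subst_op1 : subst_op (1 : 'M[R]_n) = 1.
Proof.
apply: linear_ext => phi; apply: formal_mapP => k; apply/ffunP => i.
apply: val_inj; rewrite subst_opE -[RHS]comp_mpoly_id; congr (_ \mPo _).
apply: eq_from_tnth => j; rewrite !tnth_mktuple (bigD1 j) //= mxE eqxx scale1r.
by rewrite big1 ?addr0 // => l neq_lj; rewrite mxE eq_sym (negPf neq_lj) scale0r.
Qed.

(** The order reverses because substituting [B x] for [x] in [phi (A x)] gives [phi (A B x)]. *)
Lemma subst_opM A B : subst_op (A * B) = subst_op B * subst_op A.
Proof.
apply: linear_ext => phi; apply: formal_mapP => k; apply/ffunP => i.
by apply: val_inj; rewrite endM !subst_opE comp_mpolyA comp_linear_forms.
Qed.

Lemma subst_opX A m : subst_op A ^+ m = subst_op (A ^+ m).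
Proof. by elim: m => [|m IH]; rewrite ?subst_op1 // exprSr exprS IH subst_opM. Qed.

(* All components have positive degree, hence vanish at 0. *)
Lemma subst_op0 : subst_op (0 : 'M[R]_n) = 0.
Proof.
apply: linear_ext => phi; apply: formal_mapP => k; apply/ffunP => i.
apply: val_inj; rewrite subst_opE comp_mpolyEX big_seq /= ffunE /= big1 // => m mq.
have /dhomogP/(_ _ mq) := dhomog_is_dhomog (phi k i).
rewrite /= mdegE => dm; rewrite comp_mpolyX.
have [j nz_j] : exists j, m j != 0%N.
  apply/existsP; rewrite -negb_forall; apply/forallP => m0.
  by move: dm; rewrite big1 // => j _; apply/eqP.
rewrite (bigD1 j) //= tnth_mktuple big1 => [|l _]; last by rewrite mxE scale0r.
by rewrite expr0n (negPf nz_j) mul0r scaler0.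
Qed.

Lemma mul_op_is_zmod_morphism : zmod_morphism (@mul_op R n).
Proof.
move=> A B; apply: linear_ext => phi; apply: formal_mapP => k; apply/ffunP => i.
rewrite -[RHS]/((mul_op A phi k - mul_op B phi k) i) !ffunE -sumrB.
by apply: eq_bigr => j _; rewrite !mxE scalerBl.
Qed.

Lemma mul_op_is_monoid_morphism : monoid_morphism (@mul_op R n).
Proof.
split=> [|A B]; apply: linear_ext => phi; apply: formal_mapP => k; apply/ffunP => i.
  rewrite mul_opE (bigD1 i) //= mxE eqxx scale1r big1 ?addr0 // => j neq_ji.
  by rewrite mxE eq_sym (negPf neq_ji) scale0r.
rewrite endM !mul_opE; under [RHS]eq_bigr => j _ do rewrite mul_opE scaler_sumr.
rewrite exchange_big; apply: eq_bigr => l _ /=.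
by rewrite mxE scaler_suml; apply: eq_bigr => j _; rewrite scalerA.
Qed.

HB.instance Definition _ :=
  GRing.isZmodMorphism.Build _ _ (@mul_op R n) mul_op_is_zmod_morphism.
HB.instance Definition _ :=
  GRing.isMonoidMorphism.Build _ _ (@mul_op R n) mul_op_is_monoid_morphism.

(** Multiplication forms combinations of components with constant coefficients, and substitution is
    linear on each component. *)
Lemma comm_mul_op_subst_op A B : GRing.comm (mul_op A) (subst_op B).
Proof.
apply: linear_ext => phi; apply: formal_mapP => k; apply/ffunP => i.
apply: val_inj; rewrite !endM subst_opE !mul_opE !raddf_sum.
apply: eq_bigr => j _.
by rewrite -[RHS]/((A i j *: val (phi k j)) \mPo _) comp_mpolyZ -subst_opE.
Qed.

End FormalMapOperators.

(** * Combining the two commuting triples *)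

Lemma comm_bar_m (E : pzRingType) p (x a b : E) :
  GRing.comm x a -> GRing.comm x b -> GRing.comm x (bar_m p a b).
Proof.
move=> xa xb; do 2!apply: commr_sum => ? _.
by apply: commrM; first apply: commrM; apply: commrX.
Qed.

Lemma comm_bar_h (E : pzRingType) p (x a b : E) :
  GRing.comm x a -> GRing.comm x b -> GRing.comm x (bar_h p a b).
Proof.
move=> xa xb; apply: commr_sum => i _.
by apply: commrB; apply: commrM; apply: commrX.
Qed.

Theorem theorem4p10 (R : realType) (n p : nat) (bn J P : 'M[R]_n)
    (nilp_bn : has_nilpotency_index bn p) (p_ge2 : (2 <= p)%N)
    (JNF : is_jordan_normal_form J) (unitP : P \in unitmx)
    (bnE : bn = invmx P *m J *m P) :
  let bm := invmx P *m J^T *m P in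
  is_sl2_triple (nabla_bar_m p bn bm) (Delta_bar_h p bn bm) (nabla_bar_n bn).
Proof.
move=> bm; have [bnp0 _] := nilp_bn; have p_gt0 : (0 < p)%N := ltnW p_ge2.
have Jp0 : J ^+ p = 0.
  by apply: (conj_invmx_eq0 unitP); rewrite -conj_invmxX // -[RHS]bnp0 bnE.
have qnm : quasi_inverse bn bm.
  rewrite bnE; apply: (quasi_inverse_conj unitP).
  exact/quasi_inverse_partial_perm_mx/(nilpotent_jordan_partial_perm_mx JNF Jp0).
have qsnm : quasi_inverse (subst_op bn) (subst_op bm).
  by apply: quasi_inverse_antimorph => //; [exact: subst_op1 | exact: subst_opM].
have snp0 : subst_op bn ^+ p = 0 by rewrite subst_opX bnp0 subst_op0.
(* The multiplication triple is the image of a triple of matrices under the ring morphism [mul_op];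
   the substitution triple is built directly among the operators. *)
apply: sl2_tripleB; first exact/sl2_triple_rmorph/bar_sl2_triple.
  exact: bar_sl2_triple.
move=> u v uP vP.
(* Since [u] is multiplication by a matrix, it suffices that it commutes with the two substitutions
   generating the second triple. *)
have [A ->] : exists A, u = mul_op A.
  by move: uP; rewrite !inE => /or3P[] /eqP ->; eexists.
have cA B : GRing.comm (mul_op A) (subst_op B) by exact: comm_mul_op_subst_op.
by move: vP; rewrite !inE => /or3P[] /eqP -> //;
  [exact: comm_bar_m | exact: comm_bar_h].
Qed.
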